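(* Let $F\colon[a,b]\to\mathbb{R}$ and $f\colon[a,b]\to\mathbb{R}$ be such that $LD_1F(x)=f(x)$ for all $x\in[a,b]$. If $f$ is Laplace integrable on $[a,b]$, then $\int_a^xf=F(x)-F(a)$ for all $x\in[a,b]$.
   Context: Laplace derivative: for $F$ Perron integrable near $x$, $LD_1F(x)$ is the common value, when both exist and are equal, of $\lim_{s\to\infty}s^2\int_0^\delta e^{-st}[F(x+t)-F(x)]dt$ and $\lim_{s\to\infty}(-s^2)\int_0^\delta e^{-st}[F(x-t)-F(x)]dt$ for some $\delta>0$ (one-sided at endpoints). Lower/upper derivates $\underline{LD}_1,\overline{LD}_1$ use $\liminf$/$\limsup$, minimum/maximum over the two sides. Laplace integral: a major function of $f$ is a continuous $U$ on $[a,b]$ with $\underline{LD}_1U\geqslant f$ and $\underline{LD}_1U>-\infty$ everywhere; a minor function is a continuous $V$ with $\overline{LD}_1V\leqslant f$ and $\overline{LD}_1V<\infty$ everywhere; $f$ is Laplace integrable if $\sup_V(V(b)-V(a))=\inf_U(U(b)-U(a))$ is finite, the value being $\int_a^bf$. *)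

(* Defs.v *)
From HB Require Import structures.
From mathcomp Require Import all_boot all_order all_algebra.
From mathcomp Require Import all_classical all_reals all_analysis.

Set Implicit Arguments.
Unset Strict Implicit.
Unset Printing Implicit Defensive.

Import Order.TTheory GRing.Theory Num.Theory.
Import numFieldNormedType.Exports.

Local Open Scope classical_set_scope.
Local Open Scope ring_scope.

Section Defs.
Variable R : realType.
Implicit Types (f F U V : R -> R) (a b c d x : R).

(* Lower / upper (two-sided, relative to [a,b], hence one-sided at the
   endpoints) ordinary derivates of U at x, as liminf / limsup of the
   difference quotient over the punctured neighbourhood of x in [a,b]. *)
Definition diff_quot U x : R -> \bar R := fun y => ((U y - U x) / (y - x))%:E.

Definition lower_derivate a b U x : \bar R :=
  limf_einf (diff_quot U x) (within [set y | a <= y <= b] (dnbhs x)).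

Definition upper_derivate a b U x : \bar R :=
  limf_esup (diff_quot U x) (within [set y | a <= y <= b] (dnbhs x)).

Definition perron_major f a b U : Prop :=
  forall x, a <= x <= b ->
    ((f x)%:E <= lower_derivate a b U x)%E /\ (-oo < lower_derivate a b U x)%E.

Definition perron_minor f a b V : Prop :=
  forall x, a <= x <= b ->
    (upper_derivate a b V x <= (f x)%:E)%E /\ (upper_derivate a b V x < +oo)%E.

Definition is_perron_integral f a b (I : R) : Prop :=
  ereal_sup [set ((V b - V a)%:E)%E | V in perron_minor f a b] = I%:E /\
  ereal_inf [set ((U b - U a)%:E)%E | U in perron_major f a b] = I%:E.

Definition perron_integrable f a b : Prop := exists I, is_perron_integral f a b I.

(* the value of the Perron integral (0 if not integrable) *)
Definition perron_int f a b : R := xget 0 [set I | is_perron_integral f a b I].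

Definition laplace_right F x (delta s : R) : R :=
  s ^+ 2 * perron_int (fun t => expR (- (s * t)) * (F (x + t) - F x)) 0 delta.

Definition laplace_left F x (delta s : R) : R :=
  - s ^+ 2 * perron_int (fun t => expR (- (s * t)) * (F (x - t) - F x)) 0 delta.

Definition laplace_deriv_right a b F x (l : R) : Prop :=
  exists2 delta : R, 0 < delta /\ x + delta <= b &
    perron_integrable F x (x + delta) /\
    laplace_right F x delta s @[s --> +oo] --> l.

Definition laplace_deriv_left a b F x (l : R) : Prop :=
  exists2 delta : R, 0 < delta /\ a <= x - delta &
    perron_integrable F (x - delta) x /\
    laplace_left F x delta s @[s --> +oo] --> l.

Definition is_laplace_deriv a b F x (l : R) : Prop :=
  (x < b -> laplace_deriv_right a b F x l) /\
  (a < x -> laplace_deriv_left a b F x l).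

Definition lower_laplace_right F x delta : \bar R :=
  limf_einf (fun s => (laplace_right F x delta s)%:E) (nbhs +oo%R).
Definition lower_laplace_left F x delta : \bar R :=
  limf_einf (fun s => (laplace_left F x delta s)%:E) (nbhs +oo%R).
Definition upper_laplace_right F x delta : \bar R :=
  limf_esup (fun s => (laplace_right F x delta s)%:E) (nbhs +oo%R).
Definition upper_laplace_left F x delta : \bar R :=
  limf_esup (fun s => (laplace_left F x delta s)%:E) (nbhs +oo%R).

(* \underline{LD}_1 U (x) >= f(x) and \underline{LD}_1 U (x) > -oo, the lower
   derivate being the minimum over the available sides, each computed with
   some delta > 0 for which U is Perron integrable near x. *)
Definition lower_LD_ok a b U x (l : R) : Prop :=
  (x < b -> exists2 delta : R, 0 < delta /\ x + delta <= b &
     perron_integrable U x (x + delta) /\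
     ((l%:E <= lower_laplace_right U x delta)%E /\
      (-oo < lower_laplace_right U x delta)%E)) /\
  (a < x -> exists2 delta : R, 0 < delta /\ a <= x - delta &
     perron_integrable U (x - delta) x /\
     ((l%:E <= lower_laplace_left U x delta)%E /\
      (-oo < lower_laplace_left U x delta)%E)).

Definition upper_LD_ok a b V x (l : R) : Prop :=
  (x < b -> exists2 delta : R, 0 < delta /\ x + delta <= b &
     perron_integrable V x (x + delta) /\
     ((upper_laplace_right V x delta <= l%:E)%E /\
      (upper_laplace_right V x delta < +oo)%E)) /\
  (a < x -> exists2 delta : R, 0 < delta /\ a <= x - delta &
     perron_integrable V (x - delta) x /\
     ((upper_laplace_left V x delta <= l%:E)%E /\
      (upper_laplace_left V x delta < +oo)%E)).

Definition laplace_major f a b U : Prop :=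
  {within `[a, b], continuous U} /\
  forall x, a <= x <= b -> lower_LD_ok a b U x (f x).

Definition laplace_minor f a b V : Prop :=
  {within `[a, b], continuous V} /\
  forall x, a <= x <= b -> upper_LD_ok a b V x (f x).

Definition is_laplace_integral f a b (I : R) : Prop :=
  ereal_sup [set ((V b - V a)%:E)%E | V in laplace_minor f a b] = I%:E /\
  ereal_inf [set ((U b - U a)%:E)%E | U in laplace_major f a b] = I%:E.

Definition laplace_integrable f a b : Prop :=
  exists I, is_laplace_integral f a b I.

End Defs.

(* Main.v *)
(* For a major function U put G = U - F.  Then G is locally Perron integrable and
   its lower Laplace derivates are nonnegative, and the point is that this alone,
   without any continuity of F, makes G nondecreasing.  After adding e x the
   derivates are positive.  Let H be an indefinite Perron integral of G near a
   point.  Integration by parts gives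
     int_0^d e^(-st) (G(x+t) - G(x)) dt
       = e^(-sd) K(d) + s int_0^d e^(-st) K(t) dt,
     K(t) = H(x+t) - H(x) - t G(x),
   so if H(x+t) - H(x) <= m t for small t >= 0, positivity of the right lower
   derivate forces G(x) < m; on the left it forces G(x) > m in the mirrored
   situation.  If H exceeded one of its chords, the maximum of H minus the chord
   would satisfy both with m the slope of the chord, a contradiction; so H lies
   below its chords, and the same estimate at the two ends of an interval [c, d]
   gives G(c) < (H(d) - H(c)) / (d - c) < G(d).  A compactness argument makes
   this global.  Thus U - F, and likewise F - V for minor V, is nondecreasing. *)
Require Import Defs.
From HB Require Import structures.
From mathcomp Require Import all_boot all_order all_algebra.
From mathcomp Require Import all_classical all_reals all_analysis.
From mathcomp Require Import ring lra.
Import Order.TTheory GRing.Theory Num.Theory.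
Import numFieldNormedType.Exports.
Local Open Scope classical_set_scope.
Local Open Scope ring_scope.

Set Implicit Arguments.
Unset Strict Implicit.

(** * Lower and upper limits in epsilon form *)

Lemma limf_einf_geP (R : realType) (F : set_system R) (g : R -> R)
    (l : R) : Filter F ->
  (l%:E <= limf_einf (fun t => (g t)%:E) F)%E <->
  forall e, 0 < e -> \forall t \near F, l - e <= g t.
Proof.
move=> FF; rewrite limf_einfE; split => [h e e0|h].
- have /ereal_sup_gt[_ [V FV <-] hV] :
      ((l - e)%:E < ereal_sup [set ereal_inf [set (g t)%:E | t in V] | V in F])%E.
    by apply: lt_le_trans h; rewrite lte_fin ltrBlDr ltrDl.
  apply: filterS FV => t Vt; rewrite -lee_fin (le_trans (ltW hV))//.
  by apply: ereal_inf_lbound; exists t.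
- apply/lee_subgt0Pr => e e0.
  apply: (@le_trans _ _ (ereal_inf [set (g t)%:E | t in [set t | l - e <= g t]])).
    by apply: le_ereal_inf_tmp => _ [t /= ht <-]; rewrite -EFinB lee_fin.
  by apply: ereal_sup_ubound; exists [set t | l - e <= g t] => //; exact: h.
Qed.

(* Stated with [- g] so that upper bounds become lower bounds for [- g]. *)
Lemma limf_esup_leP (R : realType) (F : set_system R) (g : R -> R)
    (l : R) : Filter F ->
  (limf_esup (fun t => (g t)%:E) F <= l%:E)%E <->
  forall e, 0 < e -> \forall t \near F, - l - e <= - g t.
Proof.
move=> FF; rewrite -(limf_einf_geP (fun t => - g t) (- l) FF).
by rewrite (limf_einfN (fun t => (g t)%:E)) EFinN leeN2.
Qed.

(** * Compactness of a segment for additive interval properties *)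

Section cousin.
Variable R : realType.
Implicit Types (a b x u v w : R).

(** Let [S] be the set of points reachable from [a]. Local validity at [sup S] together with
    additivity carries [S] past its supremum, unless that supremum is already [b]. *)
Lemma cousin (P : R -> R -> Prop) a b : a <= b ->
  (forall u v w, a <= u -> u <= v -> v <= w -> w <= b -> P u v -> P v w -> P u w) ->
  (forall x, a <= x <= b -> exists2 d, 0 < d &
     forall u v, a <= u -> u <= x -> x <= v -> v <= b -> v - u < d -> P u v) ->
  P a b.
Proof.
move=> ab Padd Ploc.
pose S := [set y | a <= y <= b /\ P a y].
have Sa : S a.
  split; first by rewrite lexx.
  have [|d d0] := Ploc a; first by rewrite lexx.
  by apply; rewrite ?subrr.
have Sb : has_sup S.
  by split; [exists a|exists b => y [/andP[]]].
have az : a <= sup S by apply: ub_le_sup => //; case: Sb.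
have zb : sup S <= b by apply: ge_sup => [|y [/andP[]]//]; exists a.
have [|d d0 hd] := Ploc (sup S); first by rewrite az.
have [y [/andP[ay yb] Pay] ylt] := sup_adherent (divr_gt0 d0 (ltr0Sn R 1)) Sb.
have yS : y <= sup S by apply: ub_le_sup => //; [case: Sb|split => //; rewrite ay].
(* The point [y] lies less than [d / 2] below the supremum and [v] at most [d / 3] above it, so
   [v - y < d]. *)
pose v := Num.min b (sup S + d / 3).
have zv : sup S <= v by rewrite /v le_min zb/=; lra.
have vb : v <= b by rewrite /v ge_min lexx.
have vd : v <= sup S + d / 3 by rewrite /v ge_min lexx orbT.
have Pyv : P y v by apply: hd => //; lra.
have Pav : P a v by apply: (Padd a y v) => //; lra.
have : v <= sup S.
  apply: ub_le_sup; first by case: Sb.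
  by split => //; apply/andP; split; lra.
rewrite {1}/v ge_min => /orP[bz|]; last by lra.
by have -> : b = v by lra.
Qed.

End cousin.

(** * Perron major functions *)

Section perron_major.
Variable R : realType.
Implicit Types (f g U V : R -> R) (a b c d x u v e : R).

(* Multiplying the difference quotient by [(v - x) ^+ 2] treats both sides of x
   at once and makes the case [v = x] harmless. *)
Definition maj f a b U := forall x, a <= x <= b -> forall e, 0 < e ->
  \forall v \near x, a <= v <= b ->
    (f x - e) * (v - x) ^+ 2 <= (U v - U x) * (v - x).

Lemma perron_majorP f a b U : perron_major f a b U <-> maj f a b U.
Proof.
have key x v k : v != x -> (k <= (U v - U x) / (v - x)) =
    (k * (v - x) ^+ 2 <= (U v - U x) * (v - x)).
  move=> vx; have vx0 : v - x != 0 by rewrite subr_eq0.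
  have p : 0 < (v - x) ^+ 2 by rewrite lt_neqAle eq_sym sqrf_eq0 vx0 sqr_ge0.
  rewrite -(ler_pM2r p (k)); congr (_ <= _); rewrite expr2 mulrA mulfVK//.
split => [h x xab e e0|h x xab].
- have [/limf_einf_geP /(_ e e0) h1 _] := h x xab.
  move: h1; rewrite /within/= /dnbhs/= => /nbhs_ballP[d/= d0 hd].
  apply/nbhs_ballP; exists d => //= v xv vab.
  have [->|vx] := eqVneq v x; first by rewrite !subrr expr0n/= !mulr0.
  by rewrite -key//; exact: hd.
- have H : ((f x)%:E <= lower_derivate a b U x)%E.
    apply/limf_einf_geP => e e0.
    have /nbhs_ballP[d/= d0 hd] := h x xab e e0.
    rewrite /within/= /dnbhs/=; apply/nbhs_ballP; exists d => //= v xv vx vab.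
    by rewrite key//; exact: hd.
  by split => //; apply: lt_le_trans H; exact: ltNyr.
Qed.

(** Minor functions are treated as negated major functions of [- f], so that each estimate below is
    proved only once. *)
Lemma perron_minorP f a b V :
  perron_minor f a b V <-> maj (fun t => - f t) a b (fun t => - V t).
Proof.
rewrite -perron_majorP; rewrite /perron_major /perron_minor.
have E x : lower_derivate a b (fun t => - V t) x = (- upper_derivate a b V x)%E.
  rewrite -(limf_einfN (diff_quot V x)); congr (limf_einf _ _); apply/funext => y/=.
  by rewrite /diff_quot /= -mulNr opprB opprK addrC.
split => h x xab; have := h x xab; rewrite E EFinN leeN2 lteNr => -[h1 h2].
  by split.
by split.
Qed.

Lemma maj_sub f a b U c d : a <= c -> d <= b -> maj f a b U -> maj f c d U.
Proof.
move=> ac db h x /andP[cx xd] e e0.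
have /(_ _ e e0) := h x; rewrite (le_trans ac cx) (le_trans xd db) => /(_ isT).
apply: filterS => v hv /andP[cv vd]; apply: hv.
by rewrite (le_trans ac cv) (le_trans vd db).
Qed.

Lemma maj_le f g a b U : (forall x, a <= x <= b -> g x <= f x) ->
  maj f a b U -> maj g a b U.
Proof.
move=> gf h x xab e e0; have := h x xab e e0; apply: filterS => v hv vab.
apply: le_trans (hv vab); apply: ler_wpM2r; first exact: sqr_ge0.
by rewrite lerD2r gf.
Qed.

Lemma majD f g a b U V : maj f a b U -> maj g a b V ->
  maj (fun t => f t + g t) a b (fun t => U t + V t).
Proof.
move=> hU hV x xab e e0; have e2 : 0 < e / 2 by lra.
apply: filterS2 (hU x xab _ e2) (hV x xab _ e2) => v h1 h2 vab.
have := lerD (h1 vab) (h2 vab); by congr (_ <= _); field.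
Qed.

(** The derivate bound is applied separately on [[u, x]] and [[x, v]] and the two are added. This
    supplies the local hypothesis of [cousin]. *)
Lemma maj_straddle f a b U x e : maj f a b U -> a <= x <= b -> 0 < e ->
  exists2 d, 0 < d & forall u v, a <= u -> u <= x -> x <= v -> v <= b ->
    v - u < d -> (f x - e) * (v - u) <= U v - U u.
Proof.
move=> h xab e0; have /nbhs_ballP[d/= d0 hd] := h x xab e e0.
exists d => // u v au ux xv vb uvd.
have h1 : (f x - e) * (v - x) <= U v - U x.
  have [->|vx] := eqVneq v x; first by rewrite !subrr mulr0.
  have p : 0 < v - x by rewrite subr_gt0 lt_neqAle eq_sym vx.
  rewrite -(ler_pM2r p) -mulrA -expr2; apply: hd; last by apply/andP; split; lra.
  by rewrite /ball/= distrC ger0_norm; lra.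
have h2 : (f x - e) * (x - u) <= U x - U u.
  have [->|ux'] := eqVneq u x; first by rewrite !subrr mulr0.
  have p : 0 < x - u by rewrite subr_gt0 lt_neqAle ux'.
  have := hd u; rewrite /ball/= ger0_norm; last lra.
  have -> : x - u < d by lra.
  have -> : a <= u <= b by apply/andP; split; lra.
  move=> /(_ isT isT) h3.
  by rewrite -(ler_pM2r p); nra.
lra.
Qed.

Lemma maj_mono f a b U : a <= b -> (forall x, a <= x <= b -> 0 <= f x) ->
  maj f a b U -> U a <= U b.
Proof.
move=> ab f0 h.
have [->//|nab] := eqVneq a b.
have ab' : 0 < b - a by rewrite subr_gt0 lt_neqAle nab.
apply/ler_addgt0Pr => e e0.
have k0 : 0 < e / (b - a) by exact: divr_gt0.
set k := e / (b - a) in k0.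
have E : e = k * (b - a) by rewrite /k divfK// gt_eqF.
suff : - k * (b - a) <= U b - U a by rewrite mulNr -E; lra.
(* Each short interval loses at most [k] times its length; these losses are additive and amount to
   [e] over all of [[a, b]]. *)
apply: (cousin (P := fun u v => - k * (v - u) <= U v - U u)) => //.
  by move=> u v w _ _ _ _ h1 h2; lra.
move=> x xab; have [d d0 hd] := maj_straddle h xab k0.
exists d => // u v au ux xv vb uvd; apply: le_trans (hd u v au ux xv vb uvd).
by apply: ler_wpM2r; [lra|have := f0 _ xab; lra].
Qed.

End perron_major.

(** * Perron integrals *)

Section perron_integral.
Variable R : realType.
Implicit Types (f g U V K P : R -> R) (a b c x v e I J s : R).

(** Only the upper half of integrability is named: the lower half is its instance at [- f] and
    [- I], so closure properties need a single argument. *)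
Definition up_integral f a b I := forall e, 0 < e ->
  exists2 U, maj f a b U & U b - U a <= I + e.

Definition has_integral f a b I :=
  up_integral f a b I /\ up_integral (fun t => - f t) a b (- I).

(** Here [V] is a negated minor function, so [U + V] is a major function of zero and hence
    nondecreasing. *)
Lemma majN_le f a b U V : a <= b -> maj f a b U ->
  maj (fun t => - f t) a b V -> - (V b - V a) <= U b - U a.
Proof.
move=> ab hU hV; have := maj_mono ab _ (majD hU hV) => /(_ _)/= h.
suff : U a + V a <= U b + V b by lra.
by apply: h => x _; rewrite subrr.
Qed.

Lemma is_perron_integralP f a b I : a <= b ->
  is_perron_integral f a b I <-> has_integral f a b I.
Proof.
move=> ab; split => [[hs hi]|[hu hl]]; split.
- move=> e e0; have : (ereal_inf [set ((U b - U a)%:E)%E | U in perron_major f a b] < (I + e)%:E)%E.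
    by rewrite hi lte_fin ltrDl.
  move=> /ereal_inf_lt[_ [U /perron_majorP hU <-]]; rewrite lte_fin => /ltW h.
  by exists U.
- move=> e e0; have : ((I - e)%:E < ereal_sup [set ((U b - U a)%:E)%E | U in perron_minor f a b])%E.
    by rewrite hs lte_fin ltrBlDl ltrDr.
  move=> /ereal_sup_gt[_ [V /perron_minorP hV <-]]; rewrite lte_fin => /ltW h.
  by exists (fun t => - V t) => //; lra.
- apply/le_anti/andP; split.
    apply: ge_ereal_sup => _ [V /perron_minorP hV <-]; rewrite lee_fin.
    apply/ler_addgt0Pr => e e0; have [U hU hUI] := hu e e0.
    by have := majN_le ab hU hV; lra.
  apply/lee_subgt0Pr => e e0; have [U hU hUI] := hl e e0.
  apply: (@le_trans _ _ (- U b - - U a)%:E); first by rewrite -EFinB lee_fin; lra.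
  apply: ereal_sup_ubound; exists (fun t => - U t) => //.
  apply/perron_minorP; move: hU; congr (maj _ _ _ _).
  by apply/funext => t; rewrite opprK.
- apply/le_anti/andP; split; last first.
    apply: le_ereal_inf_tmp => _ [U /perron_majorP hU <-]; rewrite lee_fin.
    apply/ler_addgt0Pr => e e0; have [V hV hVI] := hl e e0.
    by have := majN_le ab hU hV; lra.
  apply/lee_addgt0Pr => e e0; have [U hU hUI] := hu e e0.
  apply: (@le_trans _ _ (U b - U a)%:E); last by rewrite -EFinD lee_fin.
  by apply: ereal_inf_lbound; exists U => //; apply/perron_majorP.
Qed.

Lemma perron_integrableP f a b : a <= b ->
  perron_integrable f a b <-> exists I, has_integral f a b I.
Proof.
by move=> ab; split => -[I hI]; exists I; move: hI; rewrite is_perron_integralP.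
Qed.

Lemma has_integral_le f g a b I J : a <= b -> (forall x, a <= x <= b -> f x <= g x) ->
  has_integral f a b I -> has_integral g a b J -> I <= J.
Proof.
move=> ab fg [_ hI] [hJ _]; apply/ler_addgt0Pr => e e0.
have [V hV hVI] := hI _ (divr_gt0 e0 (ltr0Sn R 1)).
have [U hU hUJ] := hJ _ (divr_gt0 e0 (ltr0Sn R 1)).
have := majN_le ab (maj_le fg hU) hV; lra.
Qed.

Lemma perron_intE f a b I : a <= b -> has_integral f a b I -> perron_int f a b = I.
Proof.
move=> ab hI; apply: xget_unique; first by apply/is_perron_integralP.
move=> J /is_perron_integralP => /(_ ab) hJ.
by apply/le_anti/andP; split; apply: (has_integral_le ab (fun x _ => lexx (f x))).
Qed.

Lemma has_integralN f a b I : has_integral f a b I ->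
  has_integral (fun t => - f t) a b (- I).
Proof.
move=> [h1 h2]; split => //; rewrite opprK.
by move: h1; congr (up_integral _ _ _ _); apply/funext => t; rewrite opprK.
Qed.

Lemma has_integralD f g a b I J : has_integral f a b I -> has_integral g a b J ->
  has_integral (fun t => f t + g t) a b (I + J).
Proof.
have key f' g' I' J' : up_integral f' a b I' -> up_integral g' a b J' ->
    up_integral (fun t => f' t + g' t) a b (I' + J').
  move=> h1 h2 e e0.
  have [U hU hUI] := h1 _ (divr_gt0 e0 (ltr0Sn R 1)).
  have [V hV hVI] := h2 _ (divr_gt0 e0 (ltr0Sn R 1)).
  by exists (fun t => U t + V t); [exact: majD|lra].
move=> [h1 h2] [h3 h4]; split; first exact: key.
rewrite opprD; have := key _ _ _ _ h2 h4; congr (up_integral _ _ _ _).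
by apply/funext => t; rewrite opprD.
Qed.

(** The approximation is uniform in [x], and [U] is shifted by a constant to lie just below [K], the
    side that integration by parts requires. *)
Definition up_indef f a b K := forall e, 0 < e ->
  exists2 U, maj f a b U & forall x, a <= x <= b -> K x - e <= U x <= K x.

(** Continuity is asked on the whole line, so that the extreme value theorem and the fundamental
    theorem of calculus apply without subspace topologies. *)
Definition indef f a b K := [/\ continuous K, up_indef f a b K &
  up_indef (fun t => - f t) a b (fun t => - K t)].

Lemma indef_integral f a b K : a <= b -> indef f a b K ->
  has_integral f a b (K b - K a).
Proof.
have key f' K' : a <= b -> up_indef f' a b K' -> up_integral f' a b (K' b - K' a).
  move=> ab h e e0; have [U hU hUK] := h _ e0; exists U => //.
  have := hUK a; have := hUK b; rewrite !lexx ab => /(_ isT)/andP[? ?] /(_ isT)/andP[? ?]; lra.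
move=> ab [_ h1 h2]; split; first exact: key.
by have := key _ _ ab h2; congr (up_integral _ _ _ _); lra.
Qed.

Lemma indef_sub f a b K c d : a <= c -> d <= b -> indef f a b K -> indef f c d K.
Proof.
move=> ac db [h h1 h2]; split => // e e0.
  have [U hU hUK] := h1 _ e0; exists U; first exact: maj_sub hU.
  by move=> x /andP[cx xd]; apply: hUK; rewrite (le_trans ac cx) (le_trans xd db).
have [U hU hUK] := h2 _ e0; exists U; first exact: maj_sub hU.
by move=> x /andP[cx xd]; apply: hUK; rewrite (le_trans ac cx) (le_trans xd db).
Qed.

Lemma indefN f a b K : indef f a b K -> indef (fun t => - f t) a b (fun t => - K t).
Proof.
move=> [h1 h2 h3]; split => //.
  by move=> x; apply: continuousN; exact: h1.
by move: h2; congr (up_indef _ _ _ _); apply/funext => t; rewrite opprK.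
Qed.

Lemma indefD f g a b K L : indef f a b K -> indef g a b L ->
  indef (fun t => f t + g t) a b (fun t => K t + L t).
Proof.
have key f' g' (I' J' : R -> R) : up_indef f' a b I' -> up_indef g' a b J' ->
    up_indef (fun t => f' t + g' t) a b (fun t => I' t + J' t).
  move=> h1 h2 e e0.
  have [U hU hUI] := h1 _ (divr_gt0 e0 (ltr0Sn R 1)).
  have [V hV hVI] := h2 _ (divr_gt0 e0 (ltr0Sn R 1)).
  exists (fun t => U t + V t); first exact: majD.
  move=> x xab; have /andP[? ?] := hUI x xab; have /andP[? ?] := hVI x xab.
  by apply/andP; split; lra.
move=> [c1 h1 h2] [c2 h3 h4]; split.
- by move=> x; apply: continuousD; [exact: c1|exact: c2].
- exact: key.
- have := key _ _ _ _ h2 h4; congr (up_indef _ _ _ _);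
  by apply/funext => t; rewrite opprD.
Qed.

Lemma maj_der f a b K : (forall x, a <= x <= b -> is_derive x 1 K (f x)) ->
  maj f a b K.
Proof.
move=> h x xab e e0; have [dK KE] := h x xab.
have : (fun h : R => h^-1 *: (K (h + x) - K x)) @ 0^' --> f x.
  rewrite -KE; move: dK; rewrite /derivable /derive => /cvg_ex[l hl].
  have -> : lim ((fun h0 => h0^-1 *: (K (h0 *: 1 + x) - K x)) @ 0^') = l.
    exact: cvg_lim.
  by move: hl; under eq_fun do rewrite /= scaler1.
move=> /cvgrPdist_le/(_ e e0); rewrite /dnbhs /within /= => /nbhs_ballP[r/= r0 hr].
apply/nbhs_ballP; exists r => //= v xv _.
have [->|vx] := eqVneq v x; first by rewrite !subrr expr0n/= !mulr0.
have := hr (v - x); rewrite /ball/= sub0r normrN distrC subrK subr_eq0.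
move=> /(_ xv vx); rewrite ler_norml => /andP[_ h1].
have p : 0 < (v - x) ^+ 2 by rewrite exprn_even_gt0//= subr_eq0.
have -> : (K v - K x) * (v - x) = ((v - x)^-1 *: (K v - K x)) * (v - x) ^+ 2.
  rewrite /GRing.scale/=; field; by rewrite subr_eq0.
by rewrite ler_pM2r//; lra.
Qed.

Lemma indef_der f a b K : (forall x, is_derive x 1 K (f x)) -> indef f a b K.
Proof.
move=> h; split.
- move=> x; apply: differentiable_continuous; apply/derivable1_diffP.
  by have [] := h x.
- move=> e e0; exists K; first by apply: maj_der.
  by move=> x _; apply/andP; split; lra.
- move=> e e0; exists (fun t => - K t); last by move=> x _; apply/andP; split; lra.
  by apply: maj_der => x _; exact: is_deriveN.
Qed.

Lemma antiderivative K a b : a <= b -> continuous K ->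
  exists P, forall x, a <= x <= b -> is_derive x 1 P (K x).
Proof.
move=> ab cK.
(* The base point [a - 1], with [b + 1] on the right, keeps both endpoints interior, so the
   derivative is two-sided even at [a] and [b]. *)
exists (fun x => \int[lebesgue_measure]_(t in `[a - 1, x]) K t)%R => x /andP[ax xb].
have xb1 : x < b + 1 by lra.
have [|||dP PE] := @continuous_FTC1_closed R K (a - 1) x (b + 1) xb1.
- apply: continuous_compact_integrable; first exact: segment_compact.
  exact: continuous_subspaceT.
- by lra.
- exact: cK.
split; [exact: dP|by rewrite -derive1E; exact: PE].
Qed.

(** * Exponential weights and integration by parts *)

Lemma is_derive_expR_scale s x :
  is_derive x 1 (fun t : R => expR (- (s * t))) (- (s * expR (- (s * x)))).
Proof.
apply: is_derive_eq; rewrite /GRing.scale/=; ring.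
Qed.

Lemma continuous_expR_scale s : continuous (fun t : R => expR (- (s * t))).
Proof.
move=> x; apply: differentiable_continuous; apply/derivable1_diffP.
by have [] := is_derive_expR_scale s x.
Qed.

Lemma maj_shift f a b U c : maj f a b U ->
  maj (fun t => f (c + t)) (a - c) (b - c) (fun t => U (c + t)).
Proof.
move=> h x xab e e0; have cxab : a <= c + x <= b by lra.
have /nbhs_ballP[d/= d0 hd] := h _ cxab _ e0.
apply/nbhs_ballP; exists d => //= v xv vab.
have E u y : c + u - (c + y) = u - y by ring.
have := hd (c + v); rewrite /ball/= !E => /(_ xv); apply; lra.
Qed.

Lemma maj_refl f a b U : maj f a b U ->
  maj (fun t => f (- t)) (- b) (- a) (fun t => - U (- t)).
Proof.
move=> h x xab e e0; have cxab : a <= - x <= b by lra.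
have /nbhs_ballP[d/= d0 hd] := h _ cxab _ e0.
apply/nbhs_ballP; exists d => //= v xv vab.
have := hd (- v); rewrite /ball/= -opprD normrN => /(_ xv).
have -> : a <= - v <= b by lra.
move=> /(_ isT); congr (_ <= _); ring.
Qed.

(* Integration by parts: if U is a major function just below the indefinite
   integral K, then e^(-st) U + s P is one for e^(-st) f. *)
Lemma expR_mul_integral f K P a b s : a <= b -> 0 <= s -> indef f a b K ->
  (forall x, a <= x <= b -> is_derive x 1 P (expR (- (s * x)) * K x)) ->
  has_integral (fun t => expR (- (s * t)) * f t) a b
    (expR (- (s * b)) * K b - expR (- (s * a)) * K a + s * (P b - P a)).
Proof.
move=> ab s0.
have key f' K' P' : up_indef f' a b K' ->
    (forall x, a <= x <= b -> is_derive x 1 P' (expR (- (s * x)) * K' x)) ->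
  up_integral (fun t => expR (- (s * t)) * f' t) a b
    (expR (- (s * b)) * K' b - expR (- (s * a)) * K' a + s * (P' b - P' a)).
  move=> h dP e e0.
  have p : 0 < expR (- (s * a)) := expR_gt0 _.
  (* The only loss occurs at [a], where [U] may fall below [K'] by the tolerance; its weight there
     is [p], hence the choice [e / p]. *)
  have [U hU UK] := h _ (divr_gt0 e0 p).
  exists (fun t => expR (- (s * t)) * U t + s * P' t); last first.
    have /andP[_ h1] := UK b ltac:(by rewrite ab lexx).
    have /andP[h2 _] := UK a ltac:(by rewrite ab lexx).
    have h3 : expR (- (s * b)) * U b <= expR (- (s * b)) * K' b.
      by rewrite ler_pM2l// expR_gt0.
    have h4 : expR (- (s * a)) * K' a - e <= expR (- (s * a)) * U a.
      rewrite -(ler_pM2l p) in h2; apply: le_trans h2.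
      by rewrite mulrBr mulrCA divff ?mulr1// gt_eqF.
    lra.
  move=> x xab r r0; set px := expR (- (s * x)).
  have px0 : 0 < px := expR_gt0 _.
  have e1 : 0 < r / 4 / px by apply: divr_gt0 => //; lra.
  have e4 : 0 < r / 4 by lra.
  (* As [U] need not be differentiable, the increment of the product is split with [U x] frozen:
     [expR (- (s * v)) * (U v - U x)] plus [(expR (- (s * v)) - px) * U x]. The tolerance [r] is
     shared as [r / 2] for the first piece and [r / 4] each for the second and for [s * P']. *)
  have d1 : maj (fun t => - (s * expR (- (s * t))) * U x) a b
      (fun t => expR (- (s * t)) * U x).
    apply: maj_der => y _; have := is_derive_expR_scale s y => dE.
    by apply: is_derive_eq; rewrite /GRing.scale/=; ring.
  have d2 : maj (fun t => s * (expR (- (s * t)) * K' t)) a b (fun t => s * P' t).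
    apply: maj_der => y yab; have dE := dP y yab.
    by apply: is_derive_eq; rewrite /GRing.scale/=; ring.
  have c1 : \forall v \near x, px * f' x - r / 2 <= expR (- (s * v)) * (f' x - r / 4 / px).
    have : expR (- (s * v)) * (f' x - r / 4 / px) @[v --> x] --> px * (f' x - r / 4 / px).
      apply: cvgMl; exact: continuous_expR_scale.
    move=> /cvgrPdist_le/(_ _ e4); apply: filterS => v; rewrite ler_norml => /andP[_].
    by rewrite mulrBr [px * (r / 4 / px)]mulrC divfK ?gt_eqF//; lra.
  near=> v => vab.
  have h1 : (f' x - r / 4 / px) * (v - x) ^+ 2 <= (U v - U x) * (v - x).
    by move: vab; near: v; exact: hU.
  have h2 : (- (s * px) * U x - r / 4) * (v - x) ^+ 2 <=
      (expR (- (s * v)) * U x - px * U x) * (v - x).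
    by move: vab; near: v; exact: d1.
  have h3 : (s * (px * K' x) - r / 4) * (v - x) ^+ 2 <= (s * P' v - s * P' x) * (v - x).
    by move: vab; near: v; exact: d2.
  have h4 : px * f' x - r / 2 <= expR (- (s * v)) * (f' x - r / 4 / px) by near: v.
  have h5 : 0 <= s * px * (K' x - U x).
    have /andP[_ ?] := UK x xab; apply: mulr_ge0; last lra.
    by rewrite mulr_ge0// ltW.
  have pv : 0 < expR (- (s * v)) := expR_gt0 _.
  have w0 : 0 <= (v - x) ^+ 2 := sqr_ge0 _.
  move: h1; rewrite -(ler_pM2l pv) => h1.
  have h6 := ler_wpM2r w0 h4.
  have h7 := mulr_ge0 h5 w0.
  rewrite -/px.
  clear pv h4; move: (expR (- (s * v))) h1 h2 h6 => pv h1 h2 h6.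
  rewrite mulrA in h1.
  have h8 := le_trans h6 h1.
  lra.
move=> [_ h1 h2] dP; split; first exact: key.
have := key _ _ (fun t => - P t) h2 => /(_ _)/= H.
have : forall x, a <= x <= b -> is_derive x 1 (fun t => - P t) (expR (- (s * x)) * - K x).
  move=> x xab; have dE := dP x xab.
  by apply: is_derive_eq; rewrite mulrN.
move=> /H; congr (up_integral _ _ _ _); last by ring.
by apply/funext => t; rewrite mulrN.
Unshelve. all: by end_near. Qed.

Lemma indef_shift f a b K c : indef f a b K ->
  indef (fun t => f (c + t)) (a - c) (b - c) (fun t => K (c + t)).
Proof.
have key f' K' : up_indef f' a b K' ->
    up_indef (fun t => f' (c + t)) (a - c) (b - c) (fun t => K' (c + t)).
  move=> h e e0; have [U hU UK] := h _ e0.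
  exists (fun t => U (c + t)); first exact: maj_shift.
  by move=> x xab; apply: (UK (c + x)); lra.
move=> [cK h1 h2]; split; [|exact: key h1|exact: (key _ _ h2)].
by move=> x; apply: (@continuous_comp _ _ _ (fun t => c + t) K);
  [apply: cvgD; [exact: cvg_cst|exact: cvg_id]|exact: cK].
Qed.

Lemma indef_refl f a b K : indef f a b K ->
  indef (fun t => f (- t)) (- b) (- a) (fun t => - K (- t)).
Proof.
have key f' K' : up_indef f' a b K' ->
    up_indef (fun t => f' (- t)) (- b) (- a) (fun t => - K' (- t)).
  move=> h e e0; have [U hU UK] := h _ e0.
  (* The outer sign puts [U] above its target, so it is lowered by [e] again. *)
  exists (fun t => - U (- t) + - e).
    have := majD (maj_refl hU) (maj_der (f := fun=> 0) (K := fun=> - e) _).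
    move=> /(_ (fun x _ => is_derive_cst _ _ _)).
    by congr (maj _ _ _ _); apply/funext => t; rewrite addr0.
  by move=> x xab; have := UK (- x); lra.
move=> [cK h1 h2]; split; [|exact: (key _ _ h1)|].
  move=> x; apply: continuousN; apply: (@continuous_comp _ _ _ (fun t => - t) K); last exact: cK.
  exact: opp_continuous.
exact: key _ _ h2.
Qed.

(** Truncation to [[a, b]] is 1-Lipschitz; it serves to extend an indefinite integral continuously
    to the line. *)
Lemma clamp_dist a b x v : a <= b ->
  `|Num.max a (Num.min b x) - Num.max a (Num.min b v)| <= `|x - v|.
Proof.
move=> ab; rewrite ler_norml.
have := ler_norm (x - v); have := ler_norm (v - x); rewrite distrC => h1 h2.
rewrite !maxEle !minEle.
by do ! case: ifPn; rewrite -?ltNge => *; apply/andP; split; lra.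
Qed.

Lemma clampE a b x : a <= x <= b -> Num.max a (Num.min b x) = x.
Proof. by move=> /andP[ax xb]; rewrite (min_r xb) (max_r ax). Qed.

(** Near [x] the slopes of [U] and [V] are bounded below, which bounds the increments of [K] from
    one side each, up to the uniform error [e / 4]. No continuity of [U] or [V] is assumed. *)
Lemma up_indef_modulus f a b K : up_indef f a b K ->
  up_indef (fun t => - f t) a b (fun t => - K t) ->
  forall x, a <= x <= b -> forall e, 0 < e -> exists2 d, 0 < d &
    forall v, a <= v <= b -> `|x - v| < d -> `|K x - K v| <= e.
Proof.
move=> h1 h2 x xab e e0.
have [U hU UK] := h1 _ (divr_gt0 e0 (ltr0Sn R 3)).
have [V hV VK] := h2 _ (divr_gt0 e0 (ltr0Sn R 3)).
have /nbhs_ballP[d1/= d10 hd1] := hU x xab _ ltr01.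
have /nbhs_ballP[d2/= d20 hd2] := hV x xab _ ltr01.
(* One constant bounds both slopes [f x - 1] and [- f x - 1] from below by [- M]; the radius
   [e / 4 / M] then keeps the slope contribution under [e / 4]. *)
pose M := `|f x| + 1; have M0 : 0 < M by rewrite ltr_pwDr.
have fM : - M <= f x - 1 /\ - M <= - f x - 1.
  have := ler_norm (f x); have := ler_norm (- f x); rewrite normrN /M.
  by move=> ? ?; split; lra.
exists (Num.min (Num.min d1 d2) (e / 4 / M)).
  by rewrite !lt_min d10 d20/= !divr_gt0.
move=> v vab; rewrite !lt_min => /andP[/andP[xv1 xv2] xv3].
have := hd1 v xv1 vab; have := hd2 v xv2 vab.
have /andP[? ?] := UK x xab; have /andP[? ?] := UK v vab.
have /andP[? ?] := VK x xab; have /andP[? ?] := VK v vab.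
rewrite ltr_pdivlMr// in xv3.
case: fM => fM1 fM2.
have [->|vx] := eqVneq v x; first by move=> _ _; rewrite subrr normr0 ltW.
have [lt|ge] := ltP 0 (v - x).
  rewrite distrC gtr0_norm// in xv3.
  rewrite !expr2 !mulrA !(ler_pM2r lt) => h3 h4.
  have h5 : - M * (v - x) <= (f x - 1) * (v - x) by rewrite ler_pM2r.
  have h6 : - M * (v - x) <= (- f x - 1) * (v - x) by rewrite ler_pM2r.
  by rewrite ler_norml; apply/andP; split; lra.
have lt : v - x < 0 by rewrite lt_neqAle subr_eq0 vx.
rewrite distrC ltr0_norm// in xv3.
rewrite !expr2 !mulrA !(ler_nM2r lt) => h3 h4.
have h5 : (f x - 1) * (v - x) <= - M * (v - x) by rewrite ler_nM2r.
have h6 : (- f x - 1) * (v - x) <= - M * (v - x) by rewrite ler_nM2r.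
by rewrite ler_norml; apply/andP; split; lra.
Qed.

Lemma has_integral_indef f a b I : a <= b -> has_integral f a b I ->
  exists K, indef f a b K.
Proof.
move=> ab [hu hl].
pose S x := [set U x - U a | U in maj f a b].
pose k x := inf (S x).
have maj_le_sub x y U V : a <= x -> x <= y -> y <= b -> maj f a b U ->
    maj (fun t => - f t) a b V -> - (V y - V x) <= U y - U x.
  move=> ax xy yb hU hV; apply: majN_le xy (maj_sub ax yb hU) (maj_sub ax yb hV).
(* Since [U + V] is nondecreasing, its increment up to [x] is at most that up to [b]: a pair that is
   good at [b] is uniformly good. *)
have pair e : 0 < e -> exists U V, [/\ maj f a b U, maj (fun t => - f t) a b V &
    forall x, a <= x <= b -> U x - U a + (V x - V a) <= e].
  move=> e0; have [U hU UI] := hu _ (divr_gt0 e0 (ltr0Sn R 1)).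
  have [V hV VI] := hl _ (divr_gt0 e0 (ltr0Sn R 1)).
  exists U, V; split=> // x /andP[ax xb].
  have := maj_le_sub x b U V ax xb (lexx _) hU hV; lra.
have kU x U : a <= x <= b -> maj f a b U -> k x <= U x - U a.
  move=> /andP[ax xb] hU; apply: ge_inf; last by exists U.
  have [V hV _] := hl _ ltr01; exists (- (V x - V a)) => _ [U' hU' <-].
  exact: maj_le_sub.
have kV x V : a <= x <= b -> maj (fun t => - f t) a b V -> - (V x - V a) <= k x.
  move=> /andP[ax xb] hV; apply: lb_le_inf.
    by have [U hU _] := hu _ ltr01; exists (U x - U a); exists U.
  by move=> _ [U' hU' <-]; exact: maj_le_sub.
have const U0 (f0 : R -> R) r : maj f0 a b U0 -> maj f0 a b (fun t => U0 t + r).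
  move=> hU; have := majD hU (maj_der (f := fun=> 0) (K := fun=> r) _).
  move=> /(_ (fun x _ => is_derive_cst _ _ _)).
  by congr (maj _ _ _ _); apply/funext => t; rewrite addr0.
have k1 : up_indef f a b k.
  move=> e e0; have [U [V [hU hV UV]]] := pair _ e0.
  (* Subtracting [U a] normalises [U] at [a], and subtracting [e] brings it below [k], since [k x]
     is at least [- (V x - V a)]. *)
  exists (fun t => U t + (- U a - e)); first exact: const.
  by move=> x xab; have := kU x U xab hU; have := kV x V xab hV;
     have := UV x xab; lra.
have k2 : up_indef (fun t => - f t) a b (fun t => - k t).
  move=> e e0; have [U [V [hU hV UV]]] := pair _ e0.
  exists (fun t => V t + (- V a - e)); first exact: const.
  by move=> x xab; have := kU x U xab hU; have := kV x V xab hV;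
     have := UV x xab; lra.
exists (fun x => k (Num.max a (Num.min b x))); split.
- move=> x; apply/cvgrPdist_le => e e0.
  have cab y : a <= Num.max a (Num.min b y) <= b.
    by rewrite le_max lexx/= ge_max ab/= ge_min lexx.
  have [d d0 hd] := up_indef_modulus k1 k2 (cab x) e0.
  apply/nbhs_ballP; exists d => //= v xv; apply: hd => //.
  by apply: le_lt_trans xv; exact: clamp_dist.
- move=> e /k1[U hU Uk]; exists U => // x xab; rewrite clampE//; exact: Uk.
- move=> e /k2[U hU Uk]; exists U => // x xab; rewrite clampE//; exact: Uk.
Qed.

End perron_integral.

(** * Truncated Laplace transforms *)

Section laplace.
Variable R : realType.
Implicit Types (g h K L P : R -> R) (c d e s : R).

Definition laplace g d s := perron_int (fun t => expR (- (s * t)) * g t) 0 d.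

Lemma eq_laplace g h d s : g =1 h -> laplace g d s = laplace h d s.
Proof. by move=> /funext ->. Qed.

Lemma laplace_antideriv K d s : 0 <= d -> continuous K ->
  exists P, forall x, 0 <= x <= d -> is_derive x 1 P (expR (- (s * x)) * K x).
Proof.
move=> d0 cK; apply: antiderivative => // x.
by apply: cvgM; [exact: continuous_expR_scale|exact: cK].
Qed.

Lemma laplaceE g K P d s : 0 <= d -> 0 <= s -> indef g 0 d K ->
  (forall x, 0 <= x <= d -> is_derive x 1 P (expR (- (s * x)) * K x)) ->
  laplace g d s = expR (- (s * d)) * K d - K 0 + s * (P d - P 0).
Proof.
move=> d0 s0 gK dP; rewrite /laplace (perron_intE d0 (expR_mul_integral d0 s0 gK dP)).
by rewrite mulr0 oppr0 expR0 mul1r.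
Qed.

Lemma laplace_has_integral g K d s : 0 <= d -> 0 <= s -> indef g 0 d K ->
  has_integral (fun t => expR (- (s * t)) * g t) 0 d (laplace g d s).
Proof.
move=> d0 s0 gK; have [cK _ _] := gK.
have [P dP] := laplace_antideriv s d0 cK.
by have h := expR_mul_integral d0 s0 gK dP; rewrite /laplace (perron_intE d0 h).
Qed.

Lemma laplaceD g h K L d s : 0 <= d -> 0 <= s -> indef g 0 d K -> indef h 0 d L ->
  laplace (fun t => g t + h t) d s = laplace g d s + laplace h d s.
Proof.
move=> d0 s0 gK hL; apply: perron_intE => //.
have := has_integralD (laplace_has_integral d0 s0 gK) (laplace_has_integral d0 s0 hL).
by congr (has_integral _ _ _ _); apply/funext => t; rewrite mulrDr.
Qed.

Lemma laplaceN g K d s : 0 <= d -> 0 <= s -> indef g 0 d K ->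
  laplace (fun t => - g t) d s = - laplace g d s.
Proof.
move=> d0 s0 gK; apply: perron_intE => //.
have := has_integralN (laplace_has_integral d0 s0 gK).
by congr (has_integral _ _ _ _); apply/funext => t; rewrite mulrN.
Qed.

Lemma indef_addc g a b K c : indef g a b K -> indef g a b (fun t => K t + c).
Proof.
move=> gK; have := indefD gK (indef_der (f := fun=> 0) (K := fun=> c) a b _).
move=> /(_ (fun x => is_derive_cst _ _ _)).
by congr (indef _ _ _ _); apply/funext => t; rewrite addr0.
Qed.

(** With [K] normalised to vanish at 0, both terms of the integration by parts formula are
    nonpositive, although [g] itself may change sign. *)
Lemma laplace_le0 g K d s : 0 <= d -> 0 <= s -> indef g 0 d K ->
  (forall t, 0 <= t <= d -> K t <= K 0) -> laplace g d s <= 0.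
Proof.
move=> d0 s0 gK K0.
have gK' := indef_addc (- K 0) gK; have [cK _ _] := gK'.
have [P dP] := laplace_antideriv s d0 cK.
rewrite (laplaceE d0 s0 gK' dP) subrr subr0.
have h1 : K d - K 0 <= 0 by rewrite subr_le0 K0// d0 lexx.
have h2 : P d <= P 0.
  rewrite -lerN2.
  apply: (@maj_mono _ (fun t => - (expR (- (s * t)) * (K t - K 0))) _ _ (fun t => - P t)) => //.
    move=> t t0; rewrite -mulrN mulr_ge0 ?expR_ge0//.
    by have := K0 t t0; lra.
  by apply: maj_der => x xd; have dE := dP x xd; exact: is_deriveN.
have h3 : expR (- (s * d)) * (K d - K 0) <= 0 by rewrite pmulr_rle0// expR_gt0.
have h4 : s * (P d - P 0) <= 0 by rewrite mulr_ge0_le0//; lra.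
lra.
Qed.

(** With one common [P], the difference is [expR (- (s * d)) * K d - expR (- (s * c)) * K c + s * (P
    d - P c)]. Each of the three terms is at most [M * expR (- (s * c))] in absolute value. *)
Lemma laplace_tail g K d c : 0 <= c -> c <= d -> indef g 0 d K ->
  exists C, forall s, 0 <= s -> `|laplace g d s - laplace g c s| <= C * expR (- (s * c)).
Proof.
move=> c0 cd gK; have [cK _ _] := gK.
have d0 : 0 <= d by lra.
have [M KM] : exists M, forall t, 0 <= t <= d -> - M <= K t <= M.
  have [y _ hy] := EVT_max d0 (continuous_subspaceT cK).
  have [z _ hz] := EVT_min d0 (continuous_subspaceT cK).
  exists (`|K y| + `|K z|) => t t0.
  have tI : t \in `[0, d]%R by rewrite in_itv.
  have := hy t tI; have := hz t tI.
  have := ler_norm (K y); have := ler_norm (- K z); rewrite normrN.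
  by have := normr_ge0 (K y); have := normr_ge0 (K z); lra.
exists (3 * M) => s s0.
have [P dP] := laplace_antideriv s d0 cK.
have gKc := indef_sub (lexx 0) cd gK.
have dPc x : 0 <= x <= c -> is_derive x 1 P (expR (- (s * x)) * K x).
  by move=> xc; apply: dP; lra.
rewrite (laplaceE d0 s0 gK dP) (laplaceE c0 s0 gKc dPc).
(* The two values of [r] bound [s * (P d - P c)] from both sides, by monotonicity of an
   antiderivative of [s * expR (- (s * t)) * (M - r * K t)]. *)
have bd r : r = 1 \/ r = -1 ->
    r * s * (P d - P c) <= M * (expR (- (s * c)) - expR (- (s * d))).
  move=> r1; suff : - M * expR (- (s * c)) - r * s * P c <=
    - M * expR (- (s * d)) - r * s * P d by lra.
  apply: (@maj_mono _ (fun t => s * expR (- (s * t)) * (M - r * K t)) _ _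
    (fun t => - M * expR (- (s * t)) - r * s * P t)) => //.
    move=> t tcd; apply: mulr_ge0; first by rewrite mulr_ge0// expR_ge0.
    have := KM t ltac:(lra).
    by case: r1 => ->; lra.
  apply: maj_der => x xcd; have dE := dP x ltac:(lra).
  have dF := is_derive_expR_scale s x.
  by apply: is_derive_eq; rewrite /GRing.scale/=; ring.
have b1 := bd 1 (or_introl erefl); have b2 := bd (-1) (or_intror erefl).
have pd : 0 < expR (- (s * d)) := expR_gt0 _.
have pcd : expR (- (s * d)) <= expR (- (s * c)) by rewrite ler_expR lerN2 ler_wpM2l.
have pc : 0 < expR (- (s * c)) := expR_gt0 _.
have /andP[k1 k2] := KM d ltac:(by rewrite d0 lexx).
have /andP[k3 k4] := KM c ltac:(by rewrite c0).
move: (expR (- (s * c))) (expR (- (s * d))) pd pcd pc b1 b2 => p q pd pcd pc b1 b2.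
have q1 : q * K d <= q * M by rewrite ler_pM2l.
have q2 : q * - M <= q * K d by rewrite ler_pM2l.
have q3 : p * K c <= p * M by rewrite ler_pM2l.
have q4 : p * - M <= p * K c by rewrite ler_pM2l.
have M0 : 0 <= M by lra.
have q5 := ler_wpM2l M0 pcd.
rewrite ler_norml; apply/andP; split; lra.
Qed.

Lemma sqr_expR_small C c e : 0 < c -> 0 < e ->
  \forall s \near +oo, s ^+ 2 * (C * expR (- (s * c))) <= e.
Proof.
move=> c0 e0; near=> s.
have s0 : 0 < s by near: s; exact: nbhs_pinfty_gt.
(* The threshold comes from the cubic term of the exponential series, [(s * c) ^+ 3 / 6], which
   outgrows [s ^+ 2]. *)
have sC : C * 6 / (c ^+ 3 * e) <= s by near: s; apply: nbhs_pinfty_ge; rewrite num_real.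
have c3 : 0 < c ^+ 3 by rewrite exprn_gt0.
have sc : 0 <= s * c by rewrite mulr_ge0// ltW.
have := expR_ge1Dxn 2 sc; rewrite expRN.
have -> : (3`!%:R : R) = 6 by [].
move=> h.
have p : 0 < expR (s * c) := expR_gt0 _.
rewrite mulrA ler_pdivrMr//.
have h1 : e * ((s * c) ^+ 3 / 6) <= e * expR (s * c) by rewrite ler_pM2l//; lra.
apply: le_trans h1.
rewrite ler_pdivrMr in sC; last by rewrite mulr_gt0.
have s2 : 0 <= s ^+ 2 / 6 by rewrite divr_ge0// sqr_ge0.
have := ler_wpM2l s2 sC; congr (_ <= _); field.
Unshelve. all: by end_near. Qed.

Lemma laplace_linear c d s : 0 <= d -> 0 < s ->
  s ^+ 2 * laplace (fun t => c * t) d s = c - c * (s * d + 1) * expR (- (s * d)).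
Proof.
move=> d0 s0; have sn0 : s != 0 by rewrite gt_eqF.
(* An explicit antiderivative of [expR (- (s * t)) * (c * t)]. *)
pose Q t := - (c * (t / s + s ^- 2)) * expR (- (s * t)).
have hQ : indef (fun t => expR (- (s * t)) * (c * t)) 0 d Q.
  apply: indef_der => x; have dF := is_derive_expR_scale s x.
  by apply: is_derive_eq; rewrite /GRing.scale/=; field.
rewrite /laplace (perron_intE d0 (indef_integral d0 hQ)) /Q mulr0 oppr0 expR0.
by field.
Qed.

End laplace.

(** * Monotonicity *)

Section lower_right.
Variable R : realType.
Implicit Types (f F G H K L : R -> R) (a b c d x l m r s : R).

(** The right-hand condition alone, free of any ambient interval; left-hand conditions are obtained
    from it by reflection. *)
Definition lower_right_ge F x l d := [/\ 0 < d, perron_integrable F x (x + d) &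
  forall e, 0 < e -> \forall s \near +oo, l - e <= laplace_right F x d s].

Lemma laplace_rightE F x d s :
  laplace_right F x d s = s ^+ 2 * laplace (fun t => F (x + t) - F x) d s.
Proof. by []. Qed.

Lemma laplace_leftE0 F x d s :
  laplace_left F x d s = - s ^+ 2 * laplace (fun t => F (x - t) - F x) d s.
Proof. by []. Qed.

Lemma perron_integrable_indef f a b : a <= b ->
  perron_integrable f a b <-> exists K, indef f a b K.
Proof.
move=> ab; split=> [/(perron_integrableP _ ab)[I]|[K fK]].
  exact: has_integral_indef.
by apply/(perron_integrableP _ ab); exists (K b - K a); exact: indef_integral.
Qed.

Lemma indef_increment F K x d : indef F x (x + d) K ->
  indef (fun t => F (x + t) - F x) 0 d (fun t => K (x + t) - F x * t).
Proof.
move=> /indef_shift => /(_ x); rewrite subrr addrAC subrr add0r => FK.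
have := indefD FK (indef_der (f := fun=> - F x) (K := fun t => - (F x * t)) 0 d _).
apply=> y; apply: is_derive_eq; rewrite /GRing.scale/=; ring.
Qed.

(** Cutting at [c] changes the transform by an exponentially small amount, which survives neither
    the factor [s ^+ 2] nor the limit. This lets two radii be made equal, or one be fitted into an
    interval. *)
Lemma lower_right_ge_le F x l d c : 0 < c -> c <= d ->
  lower_right_ge F x l d -> lower_right_ge F x l c.
Proof.
move=> c0 cd [d0 iF hl].
have xd : x <= x + d by lra.
have [K FK] := (perron_integrable_indef F xd).1 iF.
have xcd : x + c <= x + d by lra.
have FKc := indef_sub (lexx x) xcd FK.
split => //; first by apply/perron_integrable_indef; [lra|exists K].
move=> e e0; have e2 : 0 < e / 2 by lra.
have [C hC] := laplace_tail (ltW c0) cd (indef_increment FK).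
near=> s.
have s0 : 0 <= s by near: s; apply: nbhs_pinfty_ge; rewrite num_real.
have h1 : l - e / 2 <= laplace_right F x d s by near: s; exact: hl.
have h2 : s ^+ 2 * (C * expR (- (s * c))) <= e / 2 by near: s; exact: sqr_expR_small.
have := hC s s0; rewrite ler_norml => /andP[_ h3].
have := ler_wpM2l (sqr_ge0 s) h3.
rewrite laplace_rightE in h1; rewrite laplace_rightE; lra.
Unshelve. all: by end_near. Qed.

Lemma lower_right_geD F G x l m d : lower_right_ge F x l d -> lower_right_ge G x m d ->
  lower_right_ge (fun t => F t + G t) x (l + m) d.
Proof.
move=> [d0 iF hF] [_ iG hG].
have xd : x <= x + d by lra.
have [K FK] := (perron_integrable_indef F xd).1 iF.
have [L GL] := (perron_integrable_indef G xd).1 iG.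
split => //.
  by apply/perron_integrable_indef => //; exists (fun t => K t + L t); exact: indefD.
move=> e e0; have e2 : 0 < e / 2 by lra.
near=> s.
have s0 : 0 <= s by near: s; apply: nbhs_pinfty_ge; rewrite num_real.
have h1 : l - e / 2 <= laplace_right F x d s by near: s; exact: hF.
have h2 : m - e / 2 <= laplace_right G x d s by near: s; exact: hG.
suff -> : laplace_right (fun t => F t + G t) x d s =
  laplace_right F x d s + laplace_right G x d s by lra.
have := laplaceD (ltW d0) s0 (indef_increment FK) (indef_increment GL).
rewrite !laplace_rightE -mulrDr => <-; congr (_ * _).
by apply: eq_laplace => t; ring.
Unshelve. all: by end_near. Qed.

Lemma lower_right_ge_linear c x d : 0 <= c -> 0 < d ->
  lower_right_ge (fun t => c * t) x c d.
Proof.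
move=> c0 d0; split => //.
  apply/perron_integrable_indef; first lra.
  exists (fun t => c / 2 * t ^+ 2); apply: indef_der => y.
  by apply: is_derive_eq; rewrite /GRing.scale/=; field.
move=> e e0; near=> s.
have s1 : 1 <= s by near: s; apply: nbhs_pinfty_ge; rewrite num_real.
have h : s ^+ 2 * (c * (d + 1) * expR (- (s * d))) <= e.
  by near: s; exact: sqr_expR_small.
have -> : laplace_right (fun t => c * t) x d s =
    c - c * (s * d + 1) * expR (- (s * d)).
  rewrite -laplace_linear; [|lra|lra].
  rewrite laplace_rightE; congr (_ * _).
  by apply: eq_laplace => t; ring.
(* For [s >= 1], [s * d + 1] is at most [s ^+ 2 * (d + 1)], which is the form covered by
   [sqr_expR_small]. *)
have ss : s <= s ^+ 2 by rewrite expr2 ler_peMr//; lra.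
have h1 : c * (s * d + 1) <= c * (s ^+ 2 * (d + 1)).
  by apply: ler_wpM2l => //; have := ler_wpM2r (ltW d0) ss; lra.
have := ler_wpM2r (expR_ge0 (- (s * d))) h1; lra.
Unshelve. all: by end_near. Qed.

(** If [m <= G x], then [H (x + t) - G x * t] is largest at [t = 0], so [laplace_le0] keeps the
    transform nonpositive, against the bound [l / 2] for large [s]. *)
Lemma lower_right_slope G H x l d m r : 0 < l -> lower_right_ge G x l d ->
  0 < r -> indef G x (x + r) H ->
  (forall t, 0 <= t <= r -> H (x + t) - H x <= m * t) -> G x < m.
Proof.
move=> l0 hG r0 GH Hm; rewrite ltNge; apply/negP => mG.
pose c := Num.min d r.
have d0 : 0 < d by case: hG.
have c0 : 0 < c by rewrite lt_min d0.
have cd : c <= d by rewrite ge_min lexx.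
have cr : c <= r by rewrite ge_min lexx orbT.
have [_ _ /(_ (l / 2)) hl] := lower_right_ge_le c0 cd hG.
have xcr : x + c <= x + r by lra.
have gK := indef_increment (indef_sub (lexx x) xcr GH).
have [s [s0 hs]] : exists s, 0 <= s /\ l - l / 2 <= laplace_right G x c s.
  have : \forall s \near +oo, 0 <= s /\ l - l / 2 <= laplace_right G x c s.
    near=> s; split; first by near: s; apply: nbhs_pinfty_ge; rewrite num_real.
    by near: s; apply: hl; lra.
  by move=> /filter_ex.
have := laplace_le0 (ltW c0) s0 gK => /(_ _)/= h0.
have : laplace_right G x c s <= 0.
  rewrite laplace_rightE mulr_ge0_le0 ?sqr_ge0//; apply: h0 => t tc.
  rewrite addr0 mulr0 subr0; have := Hm t ltac:(lra).
  have := ler_wpM2r (x := t) ltac:(lra) mG; lra.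
lra.
Unshelve. all: by end_near. Qed.

(* Turns left Laplace derivates at x into right ones at - x. *)
Definition point_refl F t := - F (- t).

Lemma reflK F : point_refl (point_refl F) = F.
Proof. by apply/funext => t; rewrite /point_refl !opprK. Qed.

Lemma indef_odd_refl f a b K : indef f a b K ->
  indef (point_refl f) (- b) (- a) (fun t => K (- t)).
Proof.
move=> /indef_refl/indefN; congr (indef _ _ _ _).
by apply/funext => t; rewrite opprK.
Qed.

Lemma perron_integrable_refl f a b : a <= b -> perron_integrable f a b ->
  perron_integrable (point_refl f) (- b) (- a).
Proof.
move=> ab /perron_integrable_indef => /(_ ab)[K fK].
apply/perron_integrable_indef; first by rewrite lerN2.
by exists (fun t => K (- t)); exact: indef_odd_refl.
Qed.

Lemma below_chord G H a b : a < b -> indef G a b H ->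
  (forall x, a <= x < b -> exists l d, 0 < l /\ lower_right_ge G x l d) ->
  (forall x, a < x <= b -> exists l d, 0 < l /\ lower_right_ge (point_refl G) (- x) l d) ->
  forall x, a <= x <= b -> H x <= H a + (H b - H a) / (b - a) * (x - a).
Proof.
move=> ab GH hr hl x xab; set m := (H b - H a) / (b - a).
have [cH _ _] := GH.
pose D t := H t - m * t.
have cD : continuous D.
  move=> t; apply: cvgB; first exact: cH.
  by apply: cvgM; [exact: cvg_cst|exact: cvg_id].
have [z zab zmax] := EVT_max (ltW ab) (continuous_subspaceT cD).
have mab : m * (b - a) = H b - H a by rewrite divfK// gt_eqF// subr_gt0.
have Dab : D a = D b by rewrite /D; lra.
suff Dz : D z <= D a.
  by have := zmax x; rewrite in_itv/= xab => /(_ isT); rewrite /D in Dz *; lra.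
rewrite in_itv/= in zab.
have [za|za] := leP z a; first by have -> : z = a by lra.
have [zb|zb] := leP b z; first by rewrite (_ : z = b) ?Dab//; lra.
have [l [d [l0 hd]]] := hr z ltac:(lra).
have [l' [d' [l'0 hd']]] := hl z ltac:(lra).
have DzE t : a <= t <= b -> H t - H z <= m * (t - z).
  by move=> tab; have := zmax t; rewrite in_itv/= tab /D => /(_ isT); lra.
(* At an interior maximum [z] of [D], the increments of [H] are dominated by slope [m] in both
   directions, so the right side gives [G z < m] and the left side [m < G z]. *)
have h1 : G z < m.
  apply: (lower_right_slope (r := b - z) l0 hd); first lra.
    by rewrite addrCA subrr addr0; apply: (indef_sub _ _ GH); lra.
  by move=> t tr; have := DzE (z + t) ltac:(lra); lra.
have h2 : point_refl G (- z) < - m.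
  apply: (lower_right_slope (r := z - a) l'0 hd'); first lra.
    by rewrite addKr; apply: indef_odd_refl; apply: (indef_sub _ _ GH); lra.
  by move=> t tr; rewrite /= opprD !opprK; have := DzE (z - t) ltac:(lra); lra.
by rewrite /point_refl opprK in h2; lra.
Qed.

(** The slope of the chord separates the end values: [H] below its chord is exactly what the slope
    estimate needs at [a] and, reflected, at [b]. *)
Lemma lower_right_mono_indef G H a b : a < b -> indef G a b H ->
  (forall x, a <= x < b -> exists l d, 0 < l /\ lower_right_ge G x l d) ->
  (forall x, a < x <= b -> exists l d, 0 < l /\ lower_right_ge (point_refl G) (- x) l d) ->
  G a < G b.
Proof.
move=> ab GH hr hl.
have Hchord := below_chord ab GH hr hl.
set m := (H b - H a) / (b - a) in Hchord.
have mab : m * (b - a) = H b - H a by rewrite divfK// gt_eqF// subr_gt0.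
have [l [d [l0 hd]]] := hr a ltac:(lra).
have [l' [d' [l'0 hd']]] := hl b ltac:(lra).
have h1 : G a < m.
  apply: (lower_right_slope (r := b - a) l0 hd); first lra.
    by rewrite addrCA subrr addr0; exact: GH.
  by move=> t tr; have := Hchord (a + t) ltac:(lra); lra.
have h2 : point_refl G (- b) < - m.
  apply: (lower_right_slope (r := b - a) l'0 hd'); first lra.
    by rewrite addKr; exact: (indef_odd_refl GH).
  by move=> t tr; rewrite /= opprD !opprK; have := Hchord (b - t) ltac:(lra); lra.
by rewrite /point_refl opprK in h2; lra.
Qed.

Definition lower_ge a b G x l :=
  (x < b -> exists d, lower_right_ge G x l d) /\
  (a < x -> exists d, lower_right_ge (point_refl G) (- x) l d).

Lemma lower_geD a b F G x l m : lower_ge a b F x l -> lower_ge a b G x m ->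
  lower_ge a b (fun t => F t + G t) x (l + m).
Proof.
have key F' G' y : (exists d, lower_right_ge F' y l d) ->
    (exists d, lower_right_ge G' y m d) ->
    exists d, lower_right_ge (fun t => F' t + G' t) y (l + m) d.
  move=> [c hc] [d hd]; exists (Num.min c d).
  have c0 : 0 < c by case: hc.
  have d0 : 0 < d by case: hd.
  apply: lower_right_geD; [apply: lower_right_ge_le hc|apply: lower_right_ge_le hd];
    by rewrite ?lt_min ?c0 ?ge_min ?lexx ?orbT.
move=> [F1 F2] [G1 G2]; split => xx; first by apply: key; [exact: F1|exact: G1].
rewrite (_ : point_refl _ = fun t => point_refl F t + point_refl G t).
  by apply: key; [exact: F2|exact: G2].
by apply/funext => t; rewrite /point_refl opprD.
Qed.

(** Integrability of [G] is only local and one-sided, so the strict result is used on short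
    intervals with an end at [x] and glued by [cousin]. The added slope [k] makes the derivates
    positive and costs [e] in total. *)
Lemma lower_ge_mono G a b : a <= b ->
  (forall x, a <= x <= b -> lower_ge a b G x 0) -> G a <= G b.
Proof.
move=> ab hG; apply/ler_addgt0Pr => e e0.
have [->|nab] := eqVneq a b; first lra.
have ab' : 0 < b - a by rewrite subr_gt0 lt_neqAle nab.
have k0 : 0 < e / (b - a) by exact: divr_gt0.
set k := e / (b - a) in k0.
have E : e = k * (b - a) by rewrite /k divfK// gt_eqF.
pose G' t := G t + k * t.
suff : G' a <= G' b by rewrite /G'; lra.
have hG' x : a <= x <= b -> lower_ge a b G' x k.
  move=> xab; rewrite -[k]add0r; apply: lower_geD; first exact: hG.
  split => _; exists 1; first by apply: lower_right_ge_linear; lra.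
  have := @lower_right_ge_linear k (- x) 1 (ltW k0) ltr01.
  by congr (lower_right_ge _ _ _ _); apply/funext => t; rewrite /point_refl/= mulrN opprK.
have mono u v : a <= u -> u < v -> v <= b -> perron_integrable G' u v -> G' u <= G' v.
  move=> au uv vb /perron_integrable_indef => /(_ (ltW uv))[H GH].
  apply: ltW; apply: (lower_right_mono_indef uv GH) => x xuv; exists k.
    by have [/(_ ltac:(lra))[d hd] _] := hG' x ltac:(lra); exists d.
  by have [_ /(_ ltac:(lra))[d hd]] := hG' x ltac:(lra); exists d.
apply: (cousin (P := fun u v => G' u <= G' v)) => //.
  by move=> u v w _ _ _ _; exact: le_trans.
move=> x xab; have [hr hl] := hG' x xab.
have sub u v c d : u <= c -> c <= d -> d <= v -> perron_integrable G' u v ->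
    perron_integrable G' c d.
  move=> uc cd dv /perron_integrable_indef => /(_ ltac:(lra))[H GH].
  by apply/perron_integrable_indef => //; exists H; exact: indef_sub GH.
(* The radius is the one of the derivate at [x], on which [G'] is Perron integrable; at [x = b] only
   [v = x] occurs and any radius serves. *)
have [d1 d10 h1] : exists2 d, 0 < d & forall v, x <= v -> v <= b -> v - x < d -> G' x <= G' v.
  have [xb|xb] := ltP x b; last by exists 1 => // v ? ? _; have -> : v = x by lra.
  have [d [d0 iG _]] := hr xb; exists d => // v xv vb vd.
  have [->//|nvx] := eqVneq v x.
  have xv' : x < v by rewrite lt_neqAle eq_sym nvx.
  by apply: mono => //; [lra|apply: (sub _ _ _ _ _ _ _ iG); lra].
have [d2 d20 h2] : exists2 d, 0 < d & forall u, u <= x -> a <= u -> x - u < d -> G' u <= G' x.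
  have [ax|ax] := ltP a x; last by exists 1 => // u ? ? _; have -> : u = x by lra.
  have [d [d0 iG _]] := hl ax; exists d => // u ux au ud.
  have [->//|nux] := eqVneq u x.
  have ux' : u < x by rewrite lt_neqAle nux.
  apply: mono => //; first lra.
  have xd : - x <= - x + d by lra.
  have := perron_integrable_refl xd iG; rewrite reflK opprK => iG'.
  by apply: (sub _ _ _ _ _ _ _ iG'); lra.
exists (Num.min d1 d2) => [|u v au ux xv vb]; first by rewrite lt_min d10.
rewrite lt_min => /andP[uvd1 uvd2].
have h3 : G' u <= G' x by apply: h2; [exact: ux|exact: au|lra].
have h4 : G' x <= G' v by apply: h1; [exact: xv|exact: vb|lra].
exact: le_trans h3 h4.
Qed.

(** Reflection reverses the sign of the increment of [F], which absorbs the minus sign in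
    [- s ^+ 2]. *)
Lemma laplace_leftE F x d s : 0 <= d -> 0 <= s ->
  perron_integrable (point_refl F) (- x) (- x + d) ->
  laplace_left F x d s = laplace_right (point_refl F) (- x) d s.
Proof.
move=> d0 s0 /perron_integrable_indef => /(_ ltac:(lra))[K FK].
have := laplaceN d0 s0 (indef_increment FK).
rewrite laplace_leftE0 laplace_rightE mulNr -mulrN.
have -> : (fun t => - (point_refl F (- x + t) - point_refl F (- x))) = (fun t => F (x - t) - F x).
  by apply/funext => t; rewrite /point_refl (_ : - (- x + t) = x - t) ?opprK; ring.
by move=> ->; rewrite opprK.
Qed.

End lower_right.

(** * Laplace derivates *)

Section derivates.
Variable R : realType.
Implicit Types (F G U V A B : R -> R) (a b c d x l r s : R).

Lemma eventually_ge_ext A B l : (forall s, 0 <= s -> A s = B s) ->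
  (forall e, 0 < e -> \forall s \near +oo, l - e <= A s) ->
  forall e, 0 < e -> \forall s \near +oo, l - e <= B s.
Proof.
move=> AB h e e0; have p : \forall s \near +oo, (0 : R) <= s.
  by apply: nbhs_pinfty_ge; rewrite num_real.
by apply: filterS2 p (h e e0) => s s0; rewrite AB.
Qed.

Lemma ltNy_le l (y : \bar R) : (l%:E <= y)%E -> (-oo < y)%E.
Proof. by apply: lt_le_trans; exact: ltNyr. Qed.

Lemma lty_le l (y : \bar R) : (y <= l%:E)%E -> (y < +oo)%E.
Proof. by move=> h; apply: le_lt_trans h _; exact: ltry. Qed.

Lemma perron_integrable_reflE F x d : 0 < d ->
  perron_integrable F (x - d) x <-> perron_integrable (point_refl F) (- x) (- x + d).
Proof.
move=> d0; split => iF.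
  have xd : x - d <= x by lra.
  by have := perron_integrable_refl xd iF; rewrite opprB addrC.
have xd : - x <= - x + d by lra.
by have := perron_integrable_refl xd iF; rewrite reflK opprD !opprK.
Qed.

Lemma perron_integrableN F a b : a <= b -> perron_integrable F a b ->
  perron_integrable (fun t => - F t) a b.
Proof.
move=> ab /perron_integrable_indef => /(_ ab)[K FK].
by apply/perron_integrable_indef => //; exists (fun t => - K t); exact: indefN.
Qed.

Lemma perron_integrableNE F a b : a <= b ->
  perron_integrable (fun t => - F t) a b <-> perron_integrable F a b.
Proof.
move=> ab; split; last exact: perron_integrableN.
move=> /(perron_integrableN ab); congr (perron_integrable _ _ _).
by apply/funext => t; rewrite opprK.
Qed.

Lemma laplace_rightN F x d s : 0 <= d -> 0 <= s -> perron_integrable F x (x + d) ->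
  laplace_right (fun t => - F t) x d s = - laplace_right F x d s.
Proof.
move=> d0 s0 /perron_integrable_indef => /(_ ltac:(lra))[K FK].
have := laplaceN d0 s0 (indef_increment FK).
rewrite !laplace_rightE -mulrN => <-; congr (_ * _).
by apply: eq_laplace => t; rewrite opprB opprK addrC.
Qed.

Lemma lower_rightP U x l d : 0 < d ->
  (perron_integrable U x (x + d) /\
    (l%:E <= lower_laplace_right U x d)%E /\ (-oo < lower_laplace_right U x d)%E) <->
  lower_right_ge U x l d.
Proof.
move=> d0; split => [[iU [/limf_einf_geP hl _]]|[_ iU hl]] //.
by split => //; suff h : (l%:E <= lower_laplace_right U x d)%E;
  [split => //; exact: ltNy_le h|apply/limf_einf_geP].
Qed.

Lemma lower_leftP U x l d : 0 < d ->
  (perron_integrable U (x - d) x /\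
    (l%:E <= lower_laplace_left U x d)%E /\ (-oo < lower_laplace_left U x d)%E) <->
  lower_right_ge (point_refl U) (- x) l d.
Proof.
move=> d0; split => [[/(perron_integrable_reflE _ _ d0) iU [/limf_einf_geP hl _]]|[_ iU hl]].
  split => //; apply: eventually_ge_ext hl => s s0.
  exact: laplace_leftE (ltW d0) s0 iU.
split; first by apply/perron_integrable_reflE.
suff h : (l%:E <= lower_laplace_left U x d)%E by split => //; exact: ltNy_le h.
apply/limf_einf_geP; apply: eventually_ge_ext hl => s s0.
by rewrite (laplace_leftE (ltW d0) s0 iU).
Qed.

Lemma upper_rightP V x l d : 0 < d ->
  (perron_integrable V x (x + d) /\
    (upper_laplace_right V x d <= l%:E)%E /\ (upper_laplace_right V x d < +oo)%E) <->
  lower_right_ge (fun t => - V t) x (- l) d.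
Proof.
move=> d0; have xd : x <= x + d by lra.
split => [[iV [/limf_esup_leP hl _]]|[_ /(perron_integrableNE _ xd) iV hl]].
  split => //; first exact: perron_integrableN.
  by apply: eventually_ge_ext hl => s s0; rewrite laplace_rightN// ltW.
split => //.
suff h : (upper_laplace_right V x d <= l%:E)%E by split => //; exact: lty_le h.
apply/limf_esup_leP; apply: eventually_ge_ext hl => s s0.
by rewrite laplace_rightN// ltW.
Qed.

Lemma upper_leftP V x l d : 0 < d ->
  (perron_integrable V (x - d) x /\
    (upper_laplace_left V x d <= l%:E)%E /\ (upper_laplace_left V x d < +oo)%E) <->
  lower_right_ge (point_refl (fun t => - V t)) (- x) (- l) d.
Proof.
move=> d0; have xd : - x <= - x + d by lra.
split => [[/(perron_integrable_reflE _ _ d0) iV [/limf_esup_leP hl _]]|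
          [_ /(perron_integrableNE _ xd) iV hl]].
  split => //; first exact: perron_integrableN.
  apply: eventually_ge_ext hl => s s0.
  by rewrite (laplace_leftE (ltW d0) s0 iV) -(laplace_rightN (ltW d0) s0 iV).
split; first by apply/perron_integrable_reflE.
suff h : (upper_laplace_left V x d <= l%:E)%E by split => //; exact: lty_le h.
apply/limf_esup_leP; apply: eventually_ge_ext hl => s s0.
by rewrite (laplace_leftE (ltW d0) s0 iV) -(laplace_rightN (ltW d0) s0 iV).
Qed.

(** Restores the constraint that the radius stay inside [[a, b]], which [lower_right_ge] does not
    record. *)
Lemma lower_right_ge_fit F x l r : 0 < r -> (exists d, lower_right_ge F x l d) ->
  exists2 d, 0 < d <= r & lower_right_ge F x l d.
Proof.
move=> r0 [d hd]; have d0 : 0 < d by case: hd.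
exists (Num.min d r); first by rewrite lt_min d0 r0 ge_min lexx orbT.
by apply: lower_right_ge_le hd; [rewrite lt_min d0|rewrite ge_min lexx].
Qed.

Lemma lower_LD_okP a b U x l : lower_LD_ok a b U x l <-> lower_ge a b U x l.
Proof.
split => -[hr hl]; split => xx.
- by have [d [d0 _] /(lower_rightP _ _ _ d0)] := hr xx; exists d.
- by have [d [d0 _] /(lower_leftP _ _ _ d0)] := hl xx; exists d.
- have [|d /andP[d0 db] hd] := lower_right_ge_fit _ (hr xx) (r := b - x).
    by rewrite subr_gt0.
  by exists d; [split => //; lra|apply/lower_rightP].
- have [|d /andP[d0 db] hd] := lower_right_ge_fit _ (hl xx) (r := x - a).
    by rewrite subr_gt0.
  by exists d; [split => //; lra|apply/lower_leftP].
Qed.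

Lemma upper_LD_okP a b V x l :
  upper_LD_ok a b V x l <-> lower_ge a b (fun t => - V t) x (- l).
Proof.
split => -[hr hl]; split => xx.
- by have [d [d0 _] /(upper_rightP _ _ _ d0)] := hr xx; exists d.
- by have [d [d0 _] /(upper_leftP _ _ _ d0)] := hl xx; exists d.
- have [|d /andP[d0 db] hd] := lower_right_ge_fit _ (hr xx) (r := b - x).
    by rewrite subr_gt0.
  by exists d; [split => //; lra|apply/upper_rightP].
- have [|d /andP[d0 db] hd] := lower_right_ge_fit _ (hl xx) (r := x - a).
    by rewrite subr_gt0.
  by exists d; [split => //; lra|apply/upper_leftP].
Qed.

Lemma laplace_deriv_lower_upper a b F x l : is_laplace_deriv a b F x l ->
  lower_LD_ok a b F x l /\ upper_LD_ok a b F x l.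
Proof.
have lo A : A s @[s --> +oo] --> l ->
    (l%:E <= limf_einf (fun s => (A s)%:E) (nbhs +oo%R))%E.
  move=> /cvgrPdist_le Al; apply/limf_einf_geP => e /Al.
  by apply: filterS => s; rewrite ler_norml => /andP[? ?]; lra.
have up A : A s @[s --> +oo] --> l ->
    (limf_esup (fun s => (A s)%:E) (nbhs +oo%R) <= l%:E)%E.
  move=> /cvgrPdist_le Al; apply/limf_esup_leP => e /Al.
  by apply: filterS => s; rewrite ler_norml => /andP[? ?]; lra.
move=> [hr hl]; split; split => xx.
- have [d d0 [iF /lo h]] := hr xx; exists d => //; do 2 split => //.
  exact: ltNy_le h.
- have [d d0 [iF /lo h]] := hl xx; exists d => //; do 2 split => //.
  exact: ltNy_le h.
- have [d d0 [iF /up h]] := hr xx; exists d => //; do 2 split => //.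
  exact: lty_le h.
- have [d d0 [iF /up h]] := hl xx; exists d => //; do 2 split => //.
  exact: lty_le h.
Qed.

(** The interval only decides which sides are examined, so shrinking it can only drop conditions. *)
Lemma lower_ge_sub a b c d G x l : a <= c -> d <= b -> lower_ge a b G x l ->
  lower_ge c d G x l.
Proof.
by move=> ac db [h1 h2]; split => xx; [apply: h1; exact: lt_le_trans xx db
  |apply: h2; exact: le_lt_trans ac xx].
Qed.

End derivates.

(** * Recovering a function from its Laplace derivative *)

Theorem theorem5p4 (R : realType) (a b : R) (F f : R -> R) :
  a < b ->
  (forall x, a <= x <= b -> is_laplace_deriv a b F x (f x)) ->
  laplace_integrable f a b ->
  forall x, a <= x <= b -> is_laplace_integral f a x (F x - F a).
Proof.
move=> ab hF [I [hsup hinf]] x /andP[ax xb].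
have Flo y : a <= y <= b -> lower_ge a b F y (f y).
  by move=> /hF/laplace_deriv_lower_upper[/lower_LD_okP].
have Fup y : a <= y <= b -> lower_ge a b (fun t => - F t) y (- f y).
  by move=> /hF/laplace_deriv_lower_upper[_ /upper_LD_okP].
(* The bounds [f y] for [U] and [- f y] for [- F] add up to 0, so [U - F] is nondecreasing. *)
have major_ge c d U : a <= c -> c <= d -> d <= b ->
    (forall y, c <= y <= d -> lower_ge c d U y (f y)) -> F d - F c <= U d - U c.
  move=> ac cd db hU; suff : U c - F c <= U d - F d by lra.
  apply: (lower_ge_mono (G := fun t => U t - F t)) => // y ycd.
  rewrite -(subrr (f y)); apply: lower_geD; first exact: hU.
  by apply: (lower_ge_sub ac db); apply: Fup; lra.
have minor_le c d V : a <= c -> c <= d -> d <= b ->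
    (forall y, c <= y <= d -> lower_ge c d (fun t => - V t) y (- f y)) ->
    V d - V c <= F d - F c.
  move=> ac cd db hV; suff : F c - V c <= F d - V d by lra.
  apply: (lower_ge_mono (G := fun t => F t - V t)) => // y ycd.
  rewrite -(subrr (f y)); apply: lower_geD; last exact: hV.
  by apply: (lower_ge_sub ac db); apply: Flo; lra.
have majorW U : laplace_major f a b U -> laplace_major f a x U.
  move=> [cU hU]; split.
    by apply: continuous_subspaceW cU; apply: subset_itvl; rewrite bnd_simp.
  move=> y yax; apply/lower_LD_okP; apply: (lower_ge_sub (lexx a) xb).
  by apply/lower_LD_okP/hU; lra.
have minorW V : laplace_minor f a b V -> laplace_minor f a x V.
  move=> [cV hV]; split.
    by apply: continuous_subspaceW cV; apply: subset_itvl; rewrite bnd_simp.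
  move=> y yax; apply/upper_LD_okP; apply: (lower_ge_sub (lexx a) xb).
  by apply/upper_LD_okP/hV; lra.
have majorP c d U : a <= c -> c <= d -> d <= b -> laplace_major f a b U ->
    F d - F c <= U d - U c.
  move=> ac cd db [_ hU]; apply: major_ge => // y ycd.
  by apply: (lower_ge_sub ac db); apply/lower_LD_okP/hU; lra.
have minorP c d V : a <= c -> c <= d -> d <= b -> laplace_minor f a b V ->
    V d - V c <= F d - F c.
  move=> ac cd db [_ hV]; apply: minor_le => // y ycd.
  by apply: (lower_ge_sub ac db); apply/upper_LD_okP/hV; lra.
have major_near e : 0 < e -> exists2 U, laplace_major f a b U & U b - U a <= I + e.
  move=> e0; have : (ereal_inf [set ((U b - U a)%:E)%E | U in laplace_major f a b]
    < (I + e)%:E)%E by rewrite hinf lte_fin ltrDl.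
  by move=> /ereal_inf_lt[_ [U hU <-]]; rewrite lte_fin => /ltW; exists U.
have minor_near e : 0 < e -> exists2 V, laplace_minor f a b V & I - e <= V b - V a.
  move=> e0; have : ((I - e)%:E <
    ereal_sup [set ((V b - V a)%:E)%E | V in laplace_minor f a b])%E.
    by rewrite hsup lte_fin ltrBlDl ltrDr.
  by move=> /ereal_sup_gt[_ [V hV <-]]; rewrite lte_fin => /ltW; exists V.
(* [F b - F a] lies above every minor increment and below every major one, whose extremal values
   meet at [I]. *)
have FI : F b - F a = I.
  apply/le_anti/andP; split; apply/ler_addgt0Pr => e /[dup] e0.
    move=> /major_near[U hU]; apply: le_trans.
    exact: (majorP _ _ _ (lexx a) (ltW ab) (lexx b) hU).
  move=> /minor_near[V hV].
  by have := minorP _ _ _ (lexx a) (ltW ab) (lexx b) hV; lra.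
split; apply/le_anti/andP; split.
- apply: ge_ereal_sup => _ [V [_ hV] <-]; rewrite lee_fin; apply: minor_le => // y yax.
  by apply/upper_LD_okP/hV.
(* A minor function within [e] of optimal on [[a, b]] stays so on [[a, x]], because on [[x, b]] it
   gains no more than [F] does. *)
- apply/lee_subgt0Pr => e /minor_near[V hV Vb].
  apply: (@le_trans _ _ (V x - V a)%:E).
    by rewrite -EFinB lee_fin; have := minorP _ _ _ ax xb (lexx b) hV; lra.
  by apply: ereal_sup_ubound; exists V => //; exact: minorW.
- apply/lee_addgt0Pr => e /major_near[U hU Ub].
  apply: (@le_trans _ _ (U x - U a)%:E); last first.
    by rewrite -EFinD lee_fin; have := majorP _ _ _ ax xb (lexx b) hU; lra.
  by apply: ereal_inf_lbound; exists U => //; exact: majorW.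
- apply: le_ereal_inf_tmp => _ [U [_ hU] <-]; rewrite lee_fin; apply: major_ge => // y yax.
  by apply/lower_LD_okP/hU.
Qed.
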